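(* Let $T$ be the lifetime of a coherent system whose components are identically distributed with the law of a non-negative absolutely continuous random variable $X$, and let $q$ be the distortion function of the system. Let $\phi(u)=\frac{1-u^2}{2}$. If $\phi(q(u))\ge \phi(u)$ for all $0<u<1$, then $\bar\eta^1J(T)\ge \bar\eta^1J(X)$. If $\phi(q(u))\le \phi(u)$ for all $0<u<1$, then $\bar\eta^1J(T)\le \bar\eta^1J(X)$.
   Context: For a non-negative random variable $Z$ with cumulative distribution function $F_Z$, the weighted negative cumulative extropy is $$\bar\eta^1J(Z)=\frac12\int_0^\infty x\,(1-F_Z^2(x))\,dx .$$ For a coherent system with identically distributed (possibly dependent) components having common cumulative distribution function $F_X$, the lifetime $T$ of the system has cumulative distribution function $F_T(x)=q(F_X(x))$, where the distortion function $q:[0,1]\to[0,1]$ is a continuous increasing function with $q(0)=0$ and $q(1)=1$, depending only on the structure of the system and the copula of the component lifetimes. The only property of the coherent system that is used is this representation of $F_T$. *)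

(* Defs.v *)
From HB Require Import structures.
From mathcomp Require Import all_boot all_order all_algebra.
From mathcomp Require Import all_classical all_reals all_analysis.

Set Implicit Arguments.
Unset Strict Implicit.
Unset Printing Implicit Defensive.

Import Order.TTheory GRing.Theory Num.Theory.
Import numFieldNormedType.Exports.

#[global] Open Scope classical_set_scope.
#[global] Open Scope ring_scope.

Definition cdfR (d : measure_display) (Omega : measurableType d) (R : realType)
    (P : probability Omega R) (Z : {RV P >-> R}) (x : R) : R :=
  fine (cdf Z x).

(* Extended-real valued: the integrand is nonnegative and its integral may be
   +oo. *)
Definition weighted_neg_cumulative_extropy (d : measure_display)
    (Omega : measurableType d) (R : realType)
    (P : probability Omega R) (Z : {RV P >-> R}) : \bar R :=
  ((2^-1)%:E *
   \int[lebesgue_measure]_(x in `[0%R, +oo[) (x * (1 - cdfR Z x ^+ 2))%:E)%E.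

Definition phi (R : realType) (u : R) : R := (1 - u ^+ 2) / 2.

Definition nonnegative_rv (d : measure_display) (Omega : measurableType d)
    (R : realType) (P : probability Omega R) (Z : {RV P >-> R}) : Prop :=
  {ae P, forall w, 0 <= Z w}.

Definition absolutely_continuous_rv (d : measure_display)
    (Omega : measurableType d) (R : realType) (P : probability Omega R)
    (Z : {RV P >-> R}) : Prop :=
  distribution P Z `<< (@lebesgue_measure R).

(* The two variables may live on different probability spaces. *)
Definition same_law (d d' : measure_display) (Omega : measurableType d)
    (Omega' : measurableType d') (R : realType) (P : probability Omega R)
    (P' : probability Omega' R) (Y : {RV P >-> R}) (Z : {RV P' >-> R}) : Prop :=
  forall A : set R, measurable A -> distribution P Y A = distribution P' Z A.

(* A binary structure function of n components is encoded as a boolean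
   function of the set of working components: it is coherent when it is
   monotone and every component is relevant. *)
Definition coherent (n : nat) (psi : {set 'I_n} -> bool) : Prop :=
  [/\ (0 < n)%N,
      (forall A B : {set 'I_n}, A \subset B -> psi A -> psi B) &
      (forall i : 'I_n, exists A : {set 'I_n}, psi (A :\ i) != psi (i |: A))].

(* The system works at time t (t < S) exactly when the set of components
   working at time t makes it work; this determines S from psi and Y. *)
Definition system_lifetime (d : measure_display) (Omega : measurableType d)
    (R : realType) (P : probability Omega R) (n : nat)
    (psi : {set 'I_n} -> bool) (Y : 'I_n -> {RV P >-> R})
    (S : {RV P >-> R}) : Prop :=
  forall (w : Omega) (t : R), (t < S w) = psi [set i | t < Y i w]%SET.

(* q is only meaningful on [0, 1]. "Increasing" is taken in the wide sense:
   for a general copula q may be constant on an interval. When F_X is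
   continuous the last clause determines q on [0, 1]. *)
Definition distortion_function (d d' : measure_display)
    (Omega : measurableType d) (Omega' : measurableType d') (R : realType)
    (P : probability Omega R) (P' : probability Omega' R)
    (S : {RV P >-> R}) (X : {RV P' >-> R}) (q : R -> R) : Prop :=
  [/\ (forall u : R, u \in `[0, 1] -> q u \in `[0, 1]),
      {within `[0, 1], continuous q},
      {in `[0, 1] &, {homo q : u v / u <= v}},
      q 0 = 0 /\ q 1 = 1 &
      forall x : R, cdfR S x = q (cdfR X x)].

(* Main.v *)
Require Import Defs.
From HB Require Import structures.
From mathcomp Require Import all_boot all_order all_algebra.
From mathcomp Require Import all_classical all_reals all_analysis.
From mathcomp Require Import measurable_realfun.

Import Order.TTheory GRing.Theory Num.Theory.
Import numFieldNormedType.Exports.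

(** Since [1 - F ^+ 2] is [2 * phi F], the extropy of a variable with distribution function F is the
    integral of [x * phi (F x)] over the half-line. The weight x is nonnegative there, so a
    pointwise comparison of [phi] along two distribution functions passes to the extropies
    ([le_weighted_neg_cumulative_extropy]). For the system, F_T = q o F_X, so the hypothesis on [q]
    at u = F_X(x) is exactly such a comparison. *)

Lemma cdf_fin_num {d : measure_display} {Omega : measurableType d} {R : realType}
    {P : probability Omega R} (Z : {RV P >-> R}) (x : R) :
  cdf Z x \is a fin_num.
Proof. exact: fin_num_measure. Qed.

Lemma cdfR_itv01 {d : measure_display} {Omega : measurableType d} {R : realType}
    {P : probability Omega R} (Z : {RV P >-> R}) (x : R) :
  0 <= cdfR Z x <= 1.
Proof. by rewrite -!lee_fin fineK ?cdf_fin_num// cdf_ge0 cdf_le1. Qed.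

Lemma cdfR_nondecreasing {d : measure_display} {Omega : measurableType d}
    {R : realType} {P : probability Omega R} (Z : {RV P >-> R}) :
  {homo cdfR Z : x y / x <= y}.
Proof.
by move=> x y xy; apply: fine_le; rewrite ?cdf_fin_num// cdf_nondecreasing.
Qed.

(** A distribution function is monotone, hence Borel measurable, and the integrand is a polynomial
    expression in it and x. *)
Lemma measurable_extropy_integrand {d : measure_display}
    {Omega : measurableType d} {R : realType} {P : probability Omega R}
    (Z : {RV P >-> R}) (D : set R) :
  measurable D ->
  measurable_fun D (fun x => x * (1 - cdfR Z x ^+ 2)).
Proof.
move=> mD; apply: measurable_funM => //.
apply: measurable_funB => //; apply: measurable_funX.
exact: nondecreasing_measurable (cdfR_nondecreasing Z).
Qed.

(** Monotonicity of the integral of nonnegative functions, valid in the extended reals, so either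
    side may be [+oo]. *)
Lemma le_weighted_neg_cumulative_extropy {d d' : measure_display}
    {Omega : measurableType d} {Omega' : measurableType d'} {R : realType}
    {P : probability Omega R} {P' : probability Omega' R}
    (Z : {RV P >-> R}) (W : {RV P' >-> R}) :
  (forall x, phi (cdfR Z x) <= phi (cdfR W x)) ->
  (weighted_neg_cumulative_extropy Z <= weighted_neg_cumulative_extropy W)%E.
Proof.
move=> le_phi; apply: lee_wpmul2l; first by rewrite lee_fin invr_ge0.
apply: ge0_le_integral => //.
- move=> x /=; rewrite in_itv/= andbT lee_fin => x0.
  have /andP[? ?] := cdfR_itv01 Z x.
  by rewrite mulr_ge0// subr_ge0 exprn_ile1.
- by apply/measurable_EFinP; exact: measurable_extropy_integrand.
- by apply/measurable_EFinP; exact: measurable_extropy_integrand.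
- move=> x /=; rewrite in_itv/= andbT lee_fin => x0.
  (* The weight x >= 0 factors out, and cancelling the positive factor 1/2 in [phi] leaves the
     hypothesis. *)
  by apply: ler_wpM2l => //; have := le_phi x; rewrite /phi ler_pM2r// invr_gt0.
Qed.

Theorem proposition7 (R : realType)
  (d d' : measure_display) (Omega : measurableType d)
  (Omega' : measurableType d')
  (P : probability Omega R) (P' : probability Omega' R)
  (X : {RV P' >-> R}) (n : nat) (psi : {set 'I_n} -> bool)
  (Y : 'I_n -> {RV P >-> R}) (T : {RV P >-> R}) (q : R -> R)
  (X_nonneg : nonnegative_rv X)
  (X_abs_cont : absolutely_continuous_rv X)
  (psi_coherent : coherent psi)
  (Y_law : forall i : 'I_n, same_law (Y i) X)
  (T_lifetime : system_lifetime psi Y T)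
  (q_distortion : distortion_function T X q) :
  ((forall u : R, 0 < u < 1 -> phi u <= phi (q u)) ->
     (weighted_neg_cumulative_extropy X
        <= weighted_neg_cumulative_extropy T)%E) /\
  ((forall u : R, 0 < u < 1 -> phi (q u) <= phi u) ->
     (weighted_neg_cumulative_extropy T
        <= weighted_neg_cumulative_extropy X)%E).
Proof.
case: q_distortion => _ _ _ [q0 q1] FT.
(* The hypotheses on [q] cover only the open interval, while [cdfR X] may also take the values 0 and
   1. *)
have ends (Q : R -> Prop) : Q 0 -> Q 1 -> (forall u, 0 < u < 1 -> Q u) ->
    forall x, Q (cdfR X x).
  move=> Q0 Q1 Q01 x; have /andP[] := cdfR_itv01 X x.
  rewrite le_eqVlt => /predU1P[<- //|F0]; rewrite le_eqVlt => /predU1P[-> //|F1].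
  by apply: Q01; rewrite F0.
split=> le_phi; apply: le_weighted_neg_cumulative_extropy => x; rewrite FT.
(* At both endpoints [q] fixes u, so the comparison is an equality. *)
- by apply: (ends (fun u => phi u <= phi (q u))); rewrite ?q0 ?q1.
- by apply: (ends (fun u => phi (q u) <= phi u)); rewrite ?q0 ?q1.
Qed.
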